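(* Let $(S_w^{H,n},S_n^{H,n},\mathbf u_t^{H,n},\xi_c^{H,n})_n$ be produced by the MS-P-IMPES scheme described in the context (wetting saturation updated by the discrete transport equation, non-wetting saturation updated by $S_n^{H,n+1}=1-S_w^{H,n+1}$, and $\mathbf u_t^{H,n+1}$ the postprocessed total velocity). Then for every fine element $K^h\in\mathcal T_h$, every time level $n\ge 0$ and each phase $\alpha\in\{w,n\}$, the following local mass conservation holds: $$\int_{K^h}\zeta\,\frac{S_\alpha^{H,n+1}-S_\alpha^{H,n}}{\Delta t}+\int_{\partial K^h} f_\alpha(S_{w,\alpha}^{*,H,n})\,\mathbf u_t^{H,n+1}\cdot\mathbf n=\int_{K^h}q_\alpha+\sigma_\alpha\int_{\partial K^h} f_w(S_{w,w}^{*,H,n})\,f_n(S_{w,n}^{*,H,n})\,\xi_c^{H,n+1}\cdot\mathbf n .$$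
   Context: Setting: incompressible immiscible two-phase flow in a porous domain $\Omega$ (a rectangle in $\mathbb R^2$), with phases $\alpha=w$ (wetting) and $\alpha=n$ (non-wetting), constant porosity $\zeta>0$, absolute permeability $\mathbf K$, phase mobilities $\lambda_\alpha=k_{r\alpha}/\mu_\alpha$ (functions of $S_w$), $\lambda_t=\lambda_w+\lambda_n$, fractional flows $f_\alpha=\lambda_\alpha/\lambda_t$ (functions of $S_w$), sources $q_\alpha$, $q_t=q_w+q_n$, capillary pressure function $p_c$, densities $\rho_\alpha$, gravity magnitude $g$, depth $z$, boundary pressures $p_\alpha^B$ on $\Gamma_D\subset\partial\Omega$. Put $\sigma_w=1$, $\sigma_n=-1$. $(\cdot,\cdot)$ is the $L^2(\Omega)$ inner product. Meshes and spaces: $\mathcal T_H$ is a coarse mesh of squares of side $H$; each coarse element is subdivided into squares of side $h$, giving the fine mesh $\mathcal T_h$. $V_h$ is the lowest order Raviart–Thomas space on $\mathcal T_h$; $Q_h$ and $Q_H$ are the spaces of piecewise constants on $\mathcal T_h$ and $\mathcal T_H$. $V_{\mathrm{ms}}\subset V_h$ is the multiscale velocity space of the mixed generalized multiscale finite element method: it is spanned by functions, each supported on the union $D_i=K_{i,1}\cup K_{i,2}$ of the two coarse elements sharing an interior coarse edge $E_i$, which in each of $K_{i,1},K_{i,2}$ are RT0 mixed solutions $\psi$ of $\kappa_0^{-1}\psi+\nabla p=0$, $\nabla\cdot\psi=$ const, with $\psi\cdot\mathbf n=0$ on $\partial D_i$ and prescribed normal component on $E_i$ (so $\nabla\cdot\psi$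 is constant on each coarse element), where $\kappa_0=\lambda_t(S_w^0)\mathbf K$. Upwinding: for $S_\alpha^{H,n}\in Q_h$ and an edge $e\subset\partial K^h$ shared with the neighbour $K^{h,1}$, with $\mathbf n$ outward to $K^h$, set $S_\alpha^{*,H,n}|_e=S_\alpha^{H,n}|_{K^h}$ if $\{\mathbf u_\alpha^{H,n}\cdot\mathbf n\}_e\ge0$ and $S_\alpha^{*,H,n}|_e=S_\alpha^{H,n}|_{K^{h,1}}$ otherwise ($\{\cdot\}_e$ is the average across $e$); on boundary edges the value from $K^h$ is used. Here $\mathbf u_w^{H,n+1}=f_w(S_w^{H,n})\mathbf u_t^{H,n+1}-f_wf_n(S_w^{H,n})\xi_c^{H,n+1}$, $\mathbf u_n^{H,n+1}=f_n(S_w^{H,n})\mathbf u_t^{H,n+1}+f_wf_n(S_w^{H,n})\xi_c^{H,n+1}$ (and $\mathbf u_\alpha^{H,0}$ are given initial velocities). Put $S_{w,w}^{*,H,n}=S_w^{*,H,n}$, $S_{w,n}^{*,H,n}=1-S_n^{*,H,n}$. For $q\in Q_h$, $$\beta_\alpha(\mathbf v,q;S_w^{H,n})=\sum_{K^h\in\mathcal T_h}\int_{\partial K^h}f_\alpha(S_{w,\alpha}^{*,H,n})\,\mathbf v\cdot\mathbf n\,q,\qquad \beta_c(\mathbf v,q;S_w^{H,n})=\sum_{K^h\in\mathcal T_h}\int_{\partial K^h}f_w(S_{w,w}^{*,H,n})f_n(S_{w,n}^{*,H,n})\,\mathbf v\cdot\mathbf n\,q .$$ MS-P-IMPES scheme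 (uniform time step $\Delta t=t_{n+1}-t_n$, initial data $S_w^{H,0},S_n^{H,0}\in Q_h$ with $S_w^{H,0}+S_n^{H,0}=1$). With $\kappa_n^H=\lambda_t(S_w^{H,n})\mathbf K$ and $\tilde p_c(S_w^{H,n})\in Q_H$ the average of $p_c(S_w^{H,n})$ over each coarse element: (1) find $\xi_c^{H,n+1}\in V_{\mathrm{ms}}$ with $((\kappa_n^H)^{-1}\xi_c^{H,n+1},\mathbf v)=(\tilde p_c(S_w^{H,n}),\nabla\cdot\mathbf v)-\int_{\Gamma_D}(p_n^B-p_w^B)\mathbf v\cdot\mathbf n-((\rho_n-\rho_w)g\nabla z,\mathbf v)$ for all $\mathbf v\in V_{\mathrm{ms}}$; (2) find $\mathbf u_t^{H,n+1}\in V_{\mathrm{ms}}$, $p_w^{H,n+1}\in Q_H$ with $((\kappa_n^H)^{-1}\mathbf u_t^{H,n+1},\mathbf v)-(p_w^{H,n+1},\nabla\cdot\mathbf v)=((\kappa_n^H)^{-1}f_n(S_w^{H,n})\xi_c^{H,n+1},\mathbf v)-\int_{\Gamma_D}p_w^B\mathbf v\cdot\mathbf n-(\rho_wg\nabla z,\mathbf v)$ for all $\mathbf v\in V_{\mathrm{ms}}$ and $\sum_\alpha\beta_\alpha(\mathbf u_t^{H,n+1},q;S_w^{H,n})=(q_t,q)$ for all $q\in Q_H$; then postprocess $\mathbf u_t^{H,n+1}$ locally on the fine grid in every coarse element on which $q_t$ is not constant, keeping the normal component on the coarse element boundary, so that the postprocessed velocity in $V_h$ (still denoted $\mathbf u_t^{H,n+1}$)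 satisfies $$\sum_{\alpha}\beta_\alpha(\mathbf u_t^{H,n+1},q;S_w^{H,n})=(q_t,q)\qquad\text{for all }q\in Q_h;$$ (3) find $S_w^{H,n+1}\in Q_h$ with $\big(\zeta\frac{S_w^{H,n+1}-S_w^{H,n}}{\Delta t},q\big)+\beta_w(\mathbf u_t^{H,n+1},q;S_w^{H,n})=(q_w,q)+\beta_c(\xi_c^{H,n+1},q;S_w^{H,n})$ for all $q\in Q_h$, and set $S_n^{H,n+1}=1-S_w^{H,n+1}$. *)

(* Defs.v *)
From mathcomp Require Export all_boot all_order all_algebra.
From mathcomp Require Export all_classical all_reals all_analysis.

Set Implicit Arguments.
Unset Strict Implicit.
Unset Printing Implicit Defensive.
Export Order.TTheory GRing.Theory Num.Theory.
Export numFieldNormedType.Exports.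

Local Open Scope classical_set_scope.
Local Open Scope ring_scope.

Notation plane R := (measurableTypeR R * measurableTypeR R)%type.
Notation vec R := 'cV[R]_2.

Definition area (R : realType) : {measure set (plane R) -> \bar R} :=
  ((@lebesgue_measure R) \x (@lebesgue_measure R))%E.

Definition dot (R : realType) (u v : vec R) : R := \sum_(k < 2) u k 0 * v k 0.

Definition mkvec (R : realType) (a b : R) : vec R :=
  \col_(k < 2) (if k == 0 :> nat then a else b).

Definition grad (R : realType) (z : plane R -> R) (x : plane R) : vec R :=
  mkvec ('D_((1, 0) : R^o * R^o) (z : R^o * R^o -> R^o) x)
        ('D_((0, 1) : R^o * R^o) (z : R^o * R^o -> R^o) x).

Definition divg (R : realType) (v : plane R -> vec R) (x : plane R) : R :=
  'D_((1, 0) : R^o * R^o) ((fun y => v y 0 0) : R^o * R^o -> R^o) x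
  + 'D_((0, 1) : R^o * R^o) ((fun y => v y 1 0) : R^o * R^o -> R^o) x.

Definition L2_on (R : realType) (D : set (plane R)) (f : plane R -> R) : Prop :=
  measurable_fun D f /\ (area R).-integrable D (fun x => (f x ^+ 2)%:E).

(* [ncx * ncy] coarse squares, each cut into [nsub * nsub] squares of side
   [hfine]; (xlo, ylo) is the lower-left corner of the domain. *)
Record mesh (R : realType) := Mesh {
  xlo : R;
  ylo : R;
  hfine : R;
  ncx : nat;
  ncy : nat;
  nsub : nat;
  hfine_gt0 : 0 < hfine;
  ncx_gt0 : (0 < ncx)%N;
  ncy_gt0 : (0 < ncy)%N;
  nsub_gt0 : (0 < nsub)%N }.

Definition Hcoarse (R : realType) (M : mesh R) : R := (nsub M)%:R * hfine M.

Notation fcell M := ('I_(ncx M * nsub M) * 'I_(ncy M * nsub M))%type.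
Notation ccell M := ('I_(ncx M) * 'I_(ncy M))%type.

Definition Omega (R : realType) (M : mesh R) : set (plane R) :=
  `[xlo M, xlo M + (ncx M)%:R * Hcoarse M]
  `*` `[ylo M, ylo M + (ncy M)%:R * Hcoarse M].

Definition bndOmega (R : realType) (M : mesh R) : set (plane R) :=
  (Omega M : set (R^o * R^o)) `\` (Omega M : set (R^o * R^o))°.

Definition fx (R : realType) (M : mesh R) (K : fcell M) : R :=
  xlo M + (K.1 : nat)%:R * hfine M.
Definition fy (R : realType) (M : mesh R) (K : fcell M) : R :=
  ylo M + (K.2 : nat)%:R * hfine M.

Definition fset_of (R : realType) (M : mesh R) (K : fcell M) : set (plane R) :=
  `[fx K, fx K + hfine M] `*` `[fy K, fy K + hfine M].

Definition cset_of (R : realType) (M : mesh R) (C : ccell M) : set (plane R) :=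
  `[xlo M + (C.1 : nat)%:R * Hcoarse M, xlo M + (C.1 : nat).+1%:R * Hcoarse M]
  `*`
  `[ylo M + (C.2 : nat)%:R * Hcoarse M, ylo M + (C.2 : nat).+1%:R * Hcoarse M].

Lemma parent_subproof (n m : nat) (i : 'I_(n * m)) :
  (0 < m)%N -> (i %/ m < n)%N.
Proof. by move=> m0; rewrite ltn_divLR. Qed.

Definition parent (R : realType) (M : mesh R) (K : fcell M) : ccell M :=
  (Ordinal (parent_subproof K.1 (nsub_gt0 M)),
   Ordinal (parent_subproof K.2 (nsub_gt0 M))).

Inductive side := West | East | South | North.
Definition sides : seq side := [:: West; East; South; North].

(* The cell sharing side [s] with [K]; [None] when that side is on the
   boundary of the grid. *)
Definition nbr (n1 n2 : nat) (K : 'I_n1 * 'I_n2) (s : side) :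
    option ('I_n1 * 'I_n2) :=
  match s with
  | West => if (K.1 : nat) is i.+1
            then omap (fun k => (k, K.2)) (insub i : option 'I_n1) else None
  | East => omap (fun k => (k, K.2)) (insub (K.1 : nat).+1 : option 'I_n1)
  | South => if (K.2 : nat) is j.+1
             then omap (fun k => (K.1, k)) (insub j : option 'I_n2) else None
  | North => omap (fun k => (K.1, k)) (insub (K.2 : nat).+1 : option 'I_n2)
  end.

(* Outward unit normal. *)
Definition nrm (R : realType) (s : side) : vec R :=
  match s with
  | West => mkvec (-1) 0
  | East => mkvec 1 0
  | South => mkvec 0 (-1)
  | North => mkvec 0 1
  end.

(* Unit-speed parametrization, over [0, hfine], of side [s] of [K]; both cells
   sharing an edge induce the same parametrization of it. *)
Definition edge_pt (R : realType) (M : mesh R) (K : fcell M) (s : side) (t : R) :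
    plane R :=
  match s with
  | West => (fx K, fy K + t)
  | East => (fx K + hfine M, fy K + t)
  | South => (fx K + t, fy K)
  | North => (fx K + t, fy K + hfine M)
  end.

Definition int_cell (R : realType) (M : mesh R) (K : fcell M)
    (phi : plane R -> R) : R :=
  \int[area R]_(x in fset_of K) phi x.

Definition int_edge (R : realType) (M : mesh R) (K : fcell M) (s : side)
    (phi : plane R -> R) : R :=
  \int[@lebesgue_measure R]_(t in `[0, hfine M]) phi (edge_pt K s t).

(* [phi s] is the integrand on side [s]; it may jump from side to side. *)
Definition int_bnd (R : realType) (M : mesh R) (K : fcell M)
    (phi : side -> plane R -> R) : R :=
  \sum_(s <- sides) int_edge K s (phi s).

(* Functions that may jump across fine edges are families [phi K] of local
   functions, [phi K] being used on the closed cell [K] only, so that traces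
   on both sides of an edge make sense.  An element of Q_h (resp. Q_H) is its
   family of cell values. *)
Definition int_coarse (R : realType) (M : mesh R) (C : ccell M)
    (phi : fcell M -> plane R -> R) : R :=
  \sum_(K : fcell M | parent K == C) int_cell K (phi K).

Definition ip (R : realType) (M : mesh R) (phi psi : fcell M -> plane R -> R) : R :=
  \sum_(K : fcell M) int_cell K (fun x => phi K x * psi K x).

(* A broken lowest order Raviart-Thomas field stores on each fine cell the
   coefficients (a, b, c, d) of (x, y) |-> (a + b x, c + d y). *)
Notation brt R M := {ffun fcell M -> 'rV[R]_4}.

Definition rt_val (R : realType) (c : 'rV[R]_4) (x : plane R) : vec R :=
  mkvec (c 0 0 + c 0 1 * x.1) (c 0 2%:R + c 0 3%:R * x.2).

Definition ntrace (R : realType) (M : mesh R) (v : fcell M -> 'rV[R]_4)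
    (K : fcell M) (s : side) (x : plane R) : R :=
  dot (rt_val (v K) x) (nrm R s).

Definition brt_div (R : realType) (M : mesh R) (v : fcell M -> 'rV[R]_4)
    (K : fcell M) (x : plane R) : R :=
  divg (rt_val (v K)) x.

(* RT0 on the fine mesh: broken fields with continuous normal component. *)
Definition in_Vh (R : realType) (M : mesh R) (v : fcell M -> 'rV[R]_4) : Prop :=
  forall (K K' : fcell M) (s : side), nbr K s = Some K' ->
  forall t, 0 <= t <= hfine M ->
  ntrace v K s (edge_pt K s t) = dot (rt_val (v K') (edge_pt K s t)) (nrm R s).

(* Side [s] of [K] lies on the boundary of the union of the coarse cells
   satisfying [P] (which is meant to contain [K]). *)
Definition on_bnd (R : realType) (M : mesh R) (P : pred (ccell M))
    (K : fcell M) (s : side) : bool :=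
  if nbr K s is Some K' then ~~ P (parent K') else true.

Definition no_flow (R : realType) (M : mesh R) (P : pred (ccell M))
    (v : fcell M -> 'rV[R]_4) : Prop :=
  forall (K : fcell M) (s : side), P (parent K) -> on_bnd P K s ->
  forall t, 0 <= t <= hfine M -> ntrace v K s (edge_pt K s t) = 0.

Definition supported (R : realType) (M : mesh R) (P : pred (ccell M))
    (v : fcell M -> 'rV[R]_4) : Prop :=
  forall K, ~~ P (parent K) -> v K = 0.

(* On the coarse cell [C], [psi] is the velocity of the RT0 mixed
   discretization of kappa^-1 psi + grad p = 0, div psi = const, the normal
   component of [psi] on the boundary of [C] being essential data. *)
Definition local_mixed_sol (R : realType) (M : mesh R)
    (kappa : fcell M -> plane R -> 'M[R]_2) (C : ccell M)
    (psi : fcell M -> 'rV[R]_4) : Prop :=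
  exists (p : fcell M -> R) (c : R),
    (forall v : brt R M, in_Vh v -> supported (pred1 C) v -> no_flow (pred1 C) v ->
       int_coarse C (fun K x => dot (invmx (kappa K x) *m rt_val (psi K) x)
                                    (rt_val (v K) x))
       - int_coarse C (fun K x => p K * brt_div v K x) = 0) /\
    (forall q : fcell M -> R,
       int_coarse C (fun K x => brt_div psi K x * q K)
       = int_coarse C (fun K _ => c * q K)).

(* Multiscale function of the interior coarse edge shared by [C1] and [C2];
   [g] is the prescribed normal component, constant on each fine edge, and
   indexed by the fine cell on the [C1] side. *)
Definition is_ms_fun (R : realType) (M : mesh R)
    (kappa : fcell M -> plane R -> 'M[R]_2) (psi : fcell M -> 'rV[R]_4) : Prop :=
  exists (C1 C2 : ccell M) (s : side) (g : fcell M -> R),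
    [/\ nbr C1 s = Some C2,
        in_Vh psi,
        supported (pred2 C1 C2) psi /\ no_flow (pred2 C1 C2) psi,
        (forall K K' : fcell M, parent K = C1 -> parent K' = C2 ->
           nbr K s = Some K' -> forall t, 0 <= t <= hfine M ->
           ntrace psi K s (edge_pt K s t) = g K) &
        local_mixed_sol kappa C1 psi /\ local_mixed_sol kappa C2 psi].

Inductive phase := Wet | Nonwet.

Definition sgn_ph (R : realType) (al : phase) : R :=
  if al is Wet then 1 else -1.

Record flow_data (R : realType) := FlowData {
  poro : R;
  Kperm : plane R -> 'M[R]_2;
  krel : phase -> R -> R;
  visc : phase -> R;
  src : phase -> plane R -> R;
  pcap : R -> R;
  dens : phase -> R;
  gravity : R;
  depth : plane R -> R;
  GammaD : set (plane R);
  pbnd : phase -> plane R -> R }.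

(* All of these are functions of the wetting saturation [s]. *)
Definition mob (R : realType) (D : flow_data R) (al : phase) (s : R) : R :=
  krel D al s / visc D al.
Definition mobt (R : realType) (D : flow_data R) (s : R) : R :=
  mob D Wet s + mob D Nonwet s.
Definition frac (R : realType) (D : flow_data R) (al : phase) (s : R) : R :=
  mob D al s / mobt D s.

Definition srct (R : realType) (D : flow_data R) (x : plane R) : R :=
  src D Wet x + src D Nonwet x.

Definition kappa_of (R : realType) (M : mesh R) (D : flow_data R)
    (Sw : fcell M -> R) (K : fcell M) (x : plane R) : 'M[R]_2 :=
  mobt D (Sw K) *: Kperm D x.

Definition int_GammaD (R : realType) (M : mesh R) (D : flow_data R)
    (phi : plane R -> R) (v : fcell M -> 'rV[R]_4) : R :=
  \sum_(K : fcell M) \sum_(s <- sides | ~~ isSome (nbr K s))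
    \int[@lebesgue_measure R]_(t in `[0, hfine M] `&` edge_pt K s @^-1` GammaD D)
      (phi (edge_pt K s t) * ntrace v K s (edge_pt K s t)).

(* int_Omega (kappa^-1 c u) . v, with [c] piecewise constant. *)
Definition ip_kappa (R : realType) (M : mesh R) (D : flow_data R)
    (Sw c : fcell M -> R) (u v : fcell M -> 'rV[R]_4) : R :=
  \sum_(K : fcell M) int_cell K (fun x =>
    dot (invmx (kappa_of D Sw K x) *m (c K *: rt_val (u K) x)) (rt_val (v K) x)).

(* (rho g grad z, v) *)
Definition ip_grav (R : realType) (M : mesh R) (D : flow_data R) (rho : R)
    (v : fcell M -> 'rV[R]_4) : R :=
  \sum_(K : fcell M) int_cell K (fun x =>
    dot ((rho * gravity D) *: grad (depth D) x) (rt_val (v K) x)).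

Definition pc_avg (R : realType) (M : mesh R) (D : flow_data R)
    (Sw : fcell M -> R) (C : ccell M) : R :=
  int_coarse C (fun K _ => pcap D (Sw K)) / Hcoarse M ^+ 2.

(* Normal components of RT0 fields are constant on edges, so the average
   across the edge may be read off at the midpoint. *)
Definition edge_avg (R : realType) (M : mesh R) (u : fcell M -> 'rV[R]_4)
    (K K' : fcell M) (s : side) : R :=
  let x := edge_pt K s (hfine M / 2%:R) in
  (dot (rt_val (u K) x) (nrm R s) + dot (rt_val (u K') x) (nrm R s)) / 2%:R.

(* Value attached to edge [s] of [K]; when the average vanishes it depends on
   the cell from which the edge is seen. *)
Definition upwind (R : realType) (M : mesh R) (u : fcell M -> 'rV[R]_4)
    (S : fcell M -> R) (K : fcell M) (s : side) : R :=
  if nbr K s is Some K' then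
    if 0 <= edge_avg u K K' s then S K else S K'
  else S K.

Record trajectory (R : realType) (M : mesh R) := Trajectory {
  sat : phase -> nat -> fcell M -> R;
  xic : nat -> brt R M;       (* used from index 1 on *)
  utms : nat -> brt R M;      (* total velocity in Vms, before postprocessing *)
  ut : nat -> brt R M;        (* postprocessed total velocity *)
  pw : nat -> ccell M -> R;
  u0 : phase -> brt R M }.    (* initial phase velocities *)

Definition phase_vel (R : realType) (M : mesh R) (D : flow_data R)
    (X : trajectory M) (al : phase) (n : nat) : fcell M -> 'rV[R]_4 :=
  if n is k.+1 then fun K =>
    let s := sat X Wet k K in
    frac D al s *: ut X k.+1 K
    - (sgn_ph R al * (frac D Wet s * frac D Nonwet s)) *: xic X k.+1 K
  else u0 X al.

Definition sat_star (R : realType) (M : mesh R) (D : flow_data R)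
    (X : trajectory M) (al : phase) (n : nat) : fcell M -> side -> R :=
  upwind (phase_vel D X al n) (sat X al n).

(* S_{w,al}^*: the upwind wetting saturation as seen from phase [al]. *)
Definition satw_star (R : realType) (M : mesh R) (D : flow_data R)
    (X : trajectory M) (al : phase) (n : nat) (K : fcell M) (s : side) : R :=
  if al is Wet then sat_star D X Wet n K s else 1 - sat_star D X Nonwet n K s.

Definition beta (R : realType) (M : mesh R) (D : flow_data R) (X : trajectory M)
    (al : phase) (n : nat) (v : fcell M -> 'rV[R]_4) (q : fcell M -> R) : R :=
  \sum_(K : fcell M) int_bnd K (fun s x =>
    frac D al (satw_star D X al n K s) * ntrace v K s x * q K).

Definition beta_c (R : realType) (M : mesh R) (D : flow_data R) (X : trajectory M)
    (n : nat) (v : fcell M -> 'rV[R]_4) (q : fcell M -> R) : R :=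
  \sum_(K : fcell M) int_bnd K (fun s x =>
    frac D Wet (satw_star D X Wet n K s)
    * frac D Nonwet (satw_star D X Nonwet n K s) * ntrace v K s x * q K).

(* [Vms] spans the multiscale velocity space. *)
Definition capillary_step (R : realType) (M : mesh R) (D : flow_data R)
    (Vms : seq (brt R M)) (X : trajectory M) (n : nat) : Prop :=
  xic X n.+1 \in <<Vms>>%VS /\
  forall v : brt R M, v \in <<Vms>>%VS ->
    ip_kappa D (sat X Wet n) (fun=> 1) (xic X n.+1) v
    = ip (fun K _ => pc_avg D (sat X Wet n) (parent K)) (brt_div v)
      - int_GammaD D (fun x => pbnd D Nonwet x - pbnd D Wet x) v
      - ip_grav D (dens D Nonwet - dens D Wet) v.

Definition pressure_step (R : realType) (M : mesh R) (D : flow_data R)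
    (Vms : seq (brt R M)) (X : trajectory M) (n : nat) : Prop :=
  [/\ utms X n.+1 \in <<Vms>>%VS,
      forall v : brt R M, v \in <<Vms>>%VS ->
        ip_kappa D (sat X Wet n) (fun=> 1) (utms X n.+1) v
        - ip (fun K _ => pw X n.+1 (parent K)) (brt_div v)
        = ip_kappa D (sat X Wet n) (fun K => frac D Nonwet (sat X Wet n K))
            (xic X n.+1) v
          - int_GammaD D (pbnd D Wet) v
          - ip_grav D (dens D Wet) v &
      forall q : ccell M -> R,
        beta D X Wet n (utms X n.+1) (q \o @parent R M)
        + beta D X Nonwet n (utms X n.+1) (q \o @parent R M)
        = ip (fun _ => srct D) (fun K _ => q (parent K))].

Definition ae_constant_on (R : realType) (A : set (plane R)) (f : plane R -> R) :
    Prop :=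
  exists c : R, {ae area R, forall x, A x -> f x = c}.

Definition postprocess_step (R : realType) (M : mesh R) (D : flow_data R)
    (X : trajectory M) (n : nat) : Prop :=
  [/\ in_Vh (ut X n.+1),
      forall C, ae_constant_on (cset_of C) (srct D) ->
        forall K, parent K = C -> ut X n.+1 K = utms X n.+1 K,
      forall (K : fcell M) (s : side), on_bnd (pred1 (parent K)) K s ->
        forall t, 0 <= t <= hfine M ->
        ntrace (ut X n.+1) K s (edge_pt K s t)
        = ntrace (utms X n.+1) K s (edge_pt K s t) &
      forall q : fcell M -> R,
        beta D X Wet n (ut X n.+1) q + beta D X Nonwet n (ut X n.+1) q
        = ip (fun _ => srct D) (fun K _ => q K)].

Definition saturation_step (R : realType) (M : mesh R) (D : flow_data R)
    (dt : R) (X : trajectory M) (n : nat) : Prop :=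
  (forall q : fcell M -> R,
     ip (fun K _ => poro D * ((sat X Wet n.+1 K - sat X Wet n K) / dt))
        (fun K _ => q K)
     + beta D X Wet n (ut X n.+1) q
     = ip (fun _ => src D Wet) (fun K _ => q K)
       + beta_c D X n (xic X n.+1) q) /\
  (forall K, sat X Nonwet n.+1 K = 1 - sat X Wet n.+1 K).

Definition ms_p_impes (R : realType) (M : mesh R) (D : flow_data R)
    (Vms : seq (brt R M)) (dt : R) (X : trajectory M) : Prop :=
  (forall K, sat X Wet 0 K + sat X Nonwet 0 K = 1) /\
  forall n, [/\ capillary_step D Vms X n, pressure_step D Vms X n,
                postprocess_step D X n & saturation_step D dt X n].

(* Main.v *)
Require Import Defs.
From mathcomp Require Import ring lra.

(* Testing a discrete equation with the indicator of a single fine cell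
   localizes it; the wetting balance is the localized saturation equation.
   The non-wetting balance is the localized postprocessed pressure equation
   minus the wetting balance, as the saturations sum to 1 at every time level.
   Splitting the integral of q_w + q_n needs integrability of the sources on a
   cell, which holds because they are square integrable and cells have finite
   area. *)

Local Open Scope classical_set_scope.
Local Open Scope ring_scope.

(** The dominating function is [1 + f ^+ 2]: the constant is integrable because [A] has finite
    measure, and [|f| <= 1 + f ^+ 2] pointwise. *)
Lemma integrable_of_sqr (d : measure_display) (T : measurableType d)
    (R : realType) (mu : {measure set T -> \bar R}) (A : set T) (f : T -> R) :
  measurable A -> (mu A < +oo)%E -> measurable_fun A f ->
  mu.-integrable A (fun x => (f x ^+ 2)%:E) -> mu.-integrable A (EFin \o f).
Proof.
move=> mA muA mf if2.
have i1 : mu.-integrable A (fun=> 1%:E).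
  apply/integrableP; split; first exact: measurable_cst.
  by rewrite integral_cst//= normr1 mul1e.
apply: le_integrable (integrableD mA i1 if2) => //.
  exact/measurable_realfun.measurable_EFinP.
move=> x _ /=; rewrite lee_fin [leRHS]ger0_norm ?addr_ge0 ?sqr_ge0//.
by rewrite -real_normK ?num_real//; have := normr_ge0 (f x); nra.
Qed.

Section Cells.
Variables (R : realType) (M : mesh R).

Lemma measurable_fset_of (K : fcell M) : measurable (fset_of K).
Proof. by apply: measurableX; exact: measurable_itv. Qed.

Lemma measurable_Omega : measurable (Omega M).
Proof. by apply: measurableX; exact: measurable_itv. Qed.

Lemma area_fset_of_lty (K : fcell M) : (area R (fset_of K) < +oo)%E.
Proof.
rewrite [area R _]product_measure1E; [|exact: measurable_itv..].
have itv_lty (a b : R) : (lebesgue_measure `[a, b] < +oo)%E.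
  by rewrite lebesgue_measure_itv; case: ifP => //= _; rewrite -EFinB ltry.
by apply: lte_mul_pinfty; rewrite ?ge0_fin_numE//; exact: itv_lty.
Qed.

Lemma fset_of_sub_Omega (K : fcell M) : fset_of K `<=` Omega M.
Proof.
have sub (a h : R) (i n m : nat) : 0 < h -> (i < n * m)%N ->
    `[a + i%:R * h, a + i%:R * h + h] `<=` `[a, a + n%:R * (m%:R * h)].
  move=> h0 inm; apply: subset_itv; rewrite bnd_simp.
    by rewrite lerDl mulr_ge0// ltW.
  (* The right endpoints compare as [i.+1 * h <= (n * m) * h]; dividing by [h] leaves
     [i.+1 <= n * m], which is [inm]. *)
  rewrite -addrA lerD2l mulrA -natrM -[X in _ + X]mul1r -mulrDl natr1.
  by rewrite ler_pM2r// ler_nat.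
move=> x [x1 x2]; split.
- exact: sub (hfine_gt0 M) (ltn_ord K.1) _ x1.
- exact: sub (hfine_gt0 M) (ltn_ord K.2) _ x2.
Qed.

Lemma L2_on_integrable_cell (f : plane R -> R) (K : fcell M) :
  L2_on (Omega M) f -> (area R).-integrable (fset_of K) (EFin \o f).
Proof.
move=> [mf f2]; apply: integrable_of_sqr.
- exact: measurable_fset_of.
- exact: area_fset_of_lty.
- exact: measurable_funS measurable_Omega (@fset_of_sub_Omega K) mf.
- exact: integrableS measurable_Omega (measurable_fset_of K)
    (@fset_of_sub_Omega K) f2.
Qed.

End Cells.

Section Localization.
Variables (R : realType) (M : mesh R).
Implicit Types (D : flow_data R) (X : trajectory M).

Lemma ip_indicator (phi : fcell M -> plane R -> R) (K : fcell M) :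
  ip phi (fun K' _ => (K' == K)%:R) = int_cell K (phi K).
Proof.
rewrite /ip (bigD1 K)//= big1 => [|K' /negPf nK]; rewrite /int_cell.
  by rewrite addr0; under eq_Rintegral do rewrite eqxx mulr1.
under eq_Rintegral do rewrite nK mulr0.
by rewrite Rintegral_cst ?mul0r//; exact: measurable_fset_of.
Qed.

(** Shared by [beta] and [beta_c]: in both, the test value is the last factor of the edge integrand,
    so each is an instance for a suitable [phi]. The sum keeps only the sides as seen from [K], so
    no contribution of a neighbour survives. *)
Lemma sum_int_bnd_indicator (phi : fcell M -> side -> plane R -> R)
    (K : fcell M) :
  \sum_(K' : fcell M) int_bnd K' (fun s x => phi K' s x * (K' == K)%:R)
  = int_bnd K (phi K).
Proof.
rewrite (bigD1 K)//= big1 => [|K' /negPf nK]; rewrite /int_bnd /int_edge.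
  rewrite addr0; apply: eq_bigr => s _.
  by under eq_Rintegral do rewrite eqxx mulr1.
rewrite big1// => s _.
by under eq_Rintegral do rewrite nK mulr0; rewrite Rintegral_cst// mul0r.
Qed.

Lemma beta_indicator D X al n (v : fcell M -> 'rV[R]_4) (K : fcell M) :
  beta D X al n v (fun K' => (K' == K)%:R)
  = int_bnd K (fun s x => frac D al (satw_star D X al n K s) * ntrace v K s x).
Proof. exact: sum_int_bnd_indicator. Qed.

Lemma beta_c_indicator D X n (v : fcell M -> 'rV[R]_4) (K : fcell M) :
  beta_c D X n v (fun K' => (K' == K)%:R)
  = int_bnd K (fun s x => frac D Wet (satw_star D X Wet n K s)
      * frac D Nonwet (satw_star D X Nonwet n K s) * ntrace v K s x).
Proof. exact: sum_int_bnd_indicator. Qed.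

End Localization.

Theorem theorem1 (R : realType) (M : mesh R) (D : flow_data R)
  (hporo : 0 < poro D)
  (hvisc : forall al : phase, 0 < visc D al)
  (hsrc : forall al : phase, L2_on (Omega M) (src D al))
  (hGammaD : measurable (GammaD D) /\ GammaD D `<=` bndOmega M)
  (Sw0 : plane R -> R)
  (Vms : seq (brt R M))
  (hVms : forall psi : brt R M, psi \in Vms ->
     is_ms_fun (fun (_ : fcell M) x => mobt D (Sw0 x) *: Kperm D x) psi)
  (dt : R) (hdt : 0 < dt)
  (X : trajectory M)
  (hX : ms_p_impes D Vms dt X)
  (K : fcell M) (n : nat) (al : phase) :
  int_cell K (fun _ => poro D * ((sat X al n.+1 K - sat X al n K) / dt))
  + int_bnd K (fun s x =>
      frac D al (satw_star D X al n K s) * ntrace (ut X n.+1) K s x)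
  = int_cell K (src D al)
    + sgn_ph R al * int_bnd K (fun s x =>
        frac D Wet (satw_star D X Wet n K s)
        * frac D Nonwet (satw_star D X Nonwet n K s) * ntrace (xic X n.+1) K s x).
Proof.
case: hX => sat0 step.
(* Level 0 comes from the initial data, every later level from the non-wetting update of the
   previous step. *)
have satN m K' : sat X Nonwet m K' = 1 - sat X Wet m K'.
  by case: m => [|m]; [rewrite -(sat0 K') addrC addKr|have [_ _ _ []] := step m].
have [_ _ [_ _ _ pressure] [saturation _]] := step n.
have := saturation (fun K' => (K' == K)%:R).
rewrite !ip_indicator beta_indicator beta_c_indicator => wet.
have := pressure (fun K' => (K' == K)%:R).
rewrite ip_indicator !beta_indicator => total.
case: al; first by rewrite mul1r.
have srcD : int_cell K (srct D) = int_cell K (src D Wet) + int_cell K (src D Nonwet).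
  by apply: RintegralD; [exact: measurable_fset_of|exact: L2_on_integrable_cell..].
(* The two constants 1 cancel in the time difference, which therefore changes sign between the
   phases. *)
have accN : int_cell K (fun=> poro D * ((sat X Nonwet n.+1 K - sat X Nonwet n K) / dt))
    = - int_cell K (fun=> poro D * ((sat X Wet n.+1 K - sat X Wet n K) / dt)).
  rewrite /int_cell !Rintegral_cst; [|exact: measurable_fset_of..].
  by rewrite !satN; ring.
(* With the integrals as atoms this is linear: in [total] minus [wet] the wetting flux and source
   cancel, and the capillary term acquires the sign -1. *)
rewrite accN /=; move: wet total; rewrite srcD; lra.
Qed.
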